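(* Let $n,k\geq 1$ and let ${\bf m}=(m_1,\dots,m_k)$ be an array of nonnegative integers. For every permutation $\tau\in\mathfrak{S}_k$ there exists a bijection $\Phi_k:\mathcal{A}_n^k({\bf m})\to\mathcal{A}_n^k({\bf m}')$, where ${\bf m}'=(m_{\tau(1)},m_{\tau(2)},\dots,m_{\tau(k)})$, such that for every $\mathfrak{a}\in\mathcal{A}_n^k({\bf m})$, $$\bigl(\mathrm{DEZ}(\mathfrak{a}),\mathrm{Der}(\mathfrak{a})\bigr)=\bigl(\mathrm{DES}(\Phi_k(\mathfrak{a})),\mathrm{Der}(\Phi_k(\mathfrak{a}))\bigr).$$
   Context: $[n]=\{1,\dots,n\}$ and $\mathfrak{S}_n$ is the set of permutations of $[n]$, written in one-line notation $\pi=\pi(1)\cdots\pi(n)$; $\mathrm{FIX}(\pi)=\{i:\pi(i)=i\}$. For an integer $k\ge 1$, a $k$-arrangement of $[n]$ is a pair $\mathfrak{a}=(\pi,\phi)$ with $\pi\in\mathfrak{S}_n$ and $\phi:\mathrm{FIX}(\pi)\to\{-1,-2,\dots,-k\}$ an arbitrary function; $\mathcal{A}_n^k$ is the set of them. The positive reduction $\mathrm{red}^+(w)$ of a word $w$ over the integers is obtained by replacing every occurrence of the $i$-th smallest positive letter of $w$ by $i$, for all $i$ (negative letters are unchanged). The derangement form $\mathrm{df}_k(\mathfrak{a})$ is the word obtained from $\pi(1)\cdots\pi(n)$ by replacing $\pi(i)$ with $\phi(i)$ for each $i\in\mathrm{FIX}(\pi)$ and then applying positive reduction. The permutation form $\mathrm{pf}_k(\mathfrak{a})$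 is obtained in the same way, except that $\pi(i)$ is replaced by $\phi(i)$ only for those $i\in\mathrm{FIX}(\pi)$ with $\phi(i)\neq -k$. For a word $w=w_1\cdots w_n$ over the integers, $\mathrm{DES}(w)=\{i\in[n-1]:w_i>w_{i+1}\}$ and $\mathrm{Pos}(w)$ is the subword of $w$ consisting of its positive letters. For $\mathfrak{a}\in\mathcal{A}_n^k$ set $\mathrm{DES}(\mathfrak{a})=\mathrm{DES}(\mathrm{pf}_k(\mathfrak{a}))$, $\mathrm{DEZ}(\mathfrak{a})=\mathrm{DES}(\mathrm{df}_k(\mathfrak{a}))$, $\mathrm{Der}(\mathfrak{a})=\mathrm{Pos}(\mathrm{df}_k(\mathfrak{a}))$, and $\mathrm{fix}_i(\mathfrak{a})=|\{j\in\mathrm{FIX}(\pi):\phi(j)=-i\}|$. For ${\bf m}=(m_1,\dots,m_k)$, $\mathcal{A}_n^k({\bf m})=\{\mathfrak{a}\in\mathcal{A}_n^k:\mathrm{fix}_i(\mathfrak{a})=m_i\text{ for }1\le i\le k\}$. *)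

(* Defs.v *)
From mathcomp Require Import all_boot all_order all_algebra all_fingroup.
Set Implicit Arguments. Unset Strict Implicit. Unset Printing Implicit Defensive.
Import Order.TTheory GRing.Theory Num.Theory.

(* Conventions: [n] is encoded by 'I_n (value i stands for i+1);
   the colour -c (1 <= c <= k) is encoded by Some (c-1 : 'I_k);
   phi is stored as a finite function 'I_n -> option 'I_k which is
   Some _ exactly on FIX(pi) (and None elsewhere, where it carries no info). *)

Definition arr_ok (n k : nat) (a : {perm 'I_n} * {ffun 'I_n -> option 'I_k}) :=
  [forall j, (a.1 j == j) == (a.2 j != None)].

Definition karr (n k : nat) := {a : {perm 'I_n} * {ffun 'I_n -> option 'I_k} | arr_ok a}.

Definition kperm n k (a : karr n k) : {perm 'I_n} := (val a).1.
Definition kcol n k (a : karr n k) : {ffun 'I_n -> option 'I_k} := (val a).2.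

Definition red_pos (w : seq int) : seq int :=
  [seq (if (0 < x)%R then Posz (size (undup [seq y <- w | (0 < y)%R && (y <= x)%R]))
        else x) | x <- w].

Definition df n k (a : karr n k) : seq int :=
  red_pos [seq match kcol a i with
               | Some c => (- Posz c.+1)%R
               | None => Posz (kperm a i).+1
               end | i <- enum 'I_n].

Definition pf n k (a : karr n k) : seq int :=
  red_pos [seq match kcol a i with
               | Some c => if c.+1 != k then (- Posz c.+1)%R
                           else Posz (kperm a i).+1
               | None => Posz (kperm a i).+1
               end | i <- enum 'I_n].

(* descent set of a word, positions 1-based: {i in [size w - 1] | w_i > w_(i+1)} *)
Definition DESw (w : seq int) : seq nat :=
  [seq i <- iota 1 (size w).-1 | (nth (Posz 0) w i < nth (Posz 0) w i.-1)%R].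

Definition Posw (w : seq int) : seq int := [seq x <- w | (0 < x)%R].

Definition DES n k (a : karr n k) := DESw (pf a).
Definition DEZ n k (a : karr n k) := DESw (df a).
Definition Der n k (a : karr n k) := Posw (df a).

Definition fixc n k (a : karr n k) (c : 'I_k) : nat :=
  #|[set j | kcol a j == Some c]|.

(* A_n^k(m), with m_(c+1) encoded as m c *)
Definition karr_m n k (m : 'I_k -> nat) :=
  {a : karr n k | [forall c, fixc a c == m c]}.

(* Main.v *)
Require Import Defs.
From mathcomp Require Import all_boot all_order all_algebra all_fingroup.
From mathcomp Require Import zify.
Set Implicit Arguments. Unset Strict Implicit. Unset Printing Implicit Defensive.
Import Order.TTheory GRing.Theory Num.Theory.

(* By inclusion-exclusion on the descent set it suffices to count, for every S
   and every derangement word d, the arrangements with Der = d whose word has all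
   its descents in S, i.e. is weakly increasing on each of the blocks of positions
   cut out by S.  In df_k such a block is a run of sorted negative letters followed
   by an increasing factor of d.  In pf_k it is a run of sorted negative letters,
   then uncoloured letters with pi(i) < i, then the fixed points coloured -k, then
   uncoloured letters with pi(i) > i: a fixed point placed before an anti-excedance
   or after an excedance creates a descent.  In both cases the arrangement is
   recovered from d and from the number of letters of each colour in each block,
   and all colours play the same role in these data.  Resorting every block, after
   permuting the colours, is therefore injective in both directions. *)

(** * Bijections from equal fibre sizes, and inclusion-exclusion *)

(** The element of a given rank in a fibre of [f] goes to the element of the same rank in the fibre
    of [g] over the same value. *)
Lemma bij_of_fibres (A B : finType) (T : eqType) (f : A -> T) (g : B -> T) :
  (forall t, #|[set a | f a == t]| = #|[set b | g b == t]|) ->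
  exists Phi : A -> B, bijective Phi /\ forall a, f a = g (Phi a).
Proof.
move=> H.
pose X t := enum [set a | f a == t]; pose Y t := enum [set b | g b == t].
have sXY t : size (X t) = size (Y t) by rewrite -!cardE H.
have aX a : a \in X (f a) by rewrite mem_enum inE.
have bY b : b \in Y (g b) by rewrite mem_enum inE.
have Bne a : 0 < size (Y (f a)).
  by rewrite -sXY; case: (X _) (aX a).
have Ane b : 0 < size (X (g b)).
  by rewrite sXY; case: (Y _) (bY b).
have b0 a : {b | b \in Y (f a)}.
  by case: (Y (f a)) (Bne a) => // b s _; exists b; rewrite mem_head.
have a0 b : {a | a \in X (g b)}.
  by case: (X (g b)) (Ane b) => // a s _; exists a; rewrite mem_head.
pose Phi a := nth (sval (b0 a)) (Y (f a)) (index a (X (f a))).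
pose Psi b := nth (sval (a0 b)) (X (g b)) (index b (Y (g b))).
have gPhi a : g (Phi a) = f a.
  have : Phi a \in Y (f a) by rewrite mem_nth // -sXY index_mem.
  by rewrite mem_enum inE => /eqP.
have fPsi b : f (Psi b) = g b.
  have : Psi b \in X (g b) by rewrite mem_nth // sXY index_mem.
  by rewrite mem_enum inE => /eqP.
exists Phi; split=> [|a]; last by rewrite gPhi.
exists Psi.
(* The type of [a0 (Phi a)] mentions [g (Phi a)]. As the index is in range, this default is replaced
   by [a] before rewriting with [gPhi]. *)
- move=> a; rewrite /Psi (set_nth_default a) ?index_mem ?sXY ?index_mem //.
  rewrite gPhi /Phi index_uniq ?enum_uniq ?nth_index //.
  by rewrite -sXY index_mem.
- move=> b; rewrite /Phi (set_nth_default b) ?index_mem -?sXY ?index_mem //.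
  rewrite fPsi /Psi index_uniq ?enum_uniq ?nth_index //.
  by rewrite sXY index_mem.
Qed.

(** Strong induction on [#|S|]: the count for inclusion in [S] is a sum over subsets of [S], whose
    proper terms agree by induction and cancel. *)
Lemma card_fibre_of_subset (A B I : finType) (P : pred A) (Q : pred B)
    (f : A -> {set I}) (g : B -> {set I}) :
  (forall S : {set I},
     #|[set a | P a & f a \subset S]| = #|[set b | Q b & g b \subset S]|) ->
  forall S, #|[set a | P a & f a == S]| = #|[set b | Q b & g b == S]|.
Proof.
move=> H.
have dec (C : finType) (R : pred C) (h : C -> {set I}) S :
    #|[set a | R a & h a \subset S]|
      = \sum_(U : {set I} | U \subset S) #|[set a | R a & h a == U]|.
  rewrite -sum1_card (partition_big h (fun U => U \subset S)) /=; last first.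
    by move=> a; rewrite inE => /andP[].
  apply: eq_bigr => U US; rewrite -sum1_card; apply: eq_bigl => a.
  by rewrite !inE -andbA; congr andb; rewrite andb_idl // => /eqP->.
move=> S; have [m] := ubnP #|S|; elim: m S => // m IH S leSm.
have := H S; rewrite !dec (bigD1 S) //= [RHS](bigD1 S) //=.
rewrite (eq_bigr (fun U => #|[set b | Q b & g b == U]|)); first exact: addIn.
move=> U /andP[US nUS]; apply: IH.
apply: (leq_trans (proper_card (_ : U \proper S))) => //.
by rewrite properEneq nUS.
Qed.

(** * Permutations compatible with blocks, and sorting permutations *)

(** If [blk j < blk (s j)], all positions up to and including [s j] are images of elements of [C],
    yet [C] lies strictly below [s j]: too few elements. *)
Lemma perm_block n (s : {perm 'I_n}) (blk : 'I_n -> nat) :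
    (forall i j : 'I_n, i <= j -> blk i <= blk j) ->
    (forall i j, blk i < blk j -> s i < s j) ->
  forall j, blk (s j) = blk j.
Proof.
move=> blk_mono s_blk.
have le_blk j : blk (s j) <= blk j.
  rewrite leqNgt; apply/negP => lt_blk; pose C := [set i | blk i <= blk j].
  have subC : C \subset [set x : 'I_n | x < s j].
    apply/subsetP => i; rewrite !inE => le_i.
    by rewrite ltnNge; apply/negP => /blk_mono; lia.
  have supC : [set x : 'I_n | x <= s j] \subset s @: C.
    apply/subsetP => x; rewrite inE -(permKV s x) => le_x.
    apply: imset_f; rewrite inE leqNgt; apply/negP => /s_blk; lia.
  have := leq_trans (subset_leq_card supC) (leq_imset_card _ _).
  rewrite leqNgt => /negP; apply; apply: leq_ltn_trans (subset_leq_card subC) _.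
  apply: proper_card; apply/properP; split.
    by apply/subsetP => x; rewrite !inE => /ltnW.
  by exists (s j); rewrite !inE ?ltnn ?leqnn.
(* The sums of [blk (s j)] and of [blk j] coincide, so the termwise inequalities are equalities. *)
have := @leqif_sum _ xpredT (fun j => blk (s j) == blk j)
  (fun j => blk (s j)) blk (fun j _ => conj (le_blk j) erefl).
rewrite -(reindex_inj (F := blk) (P := xpredT) (@perm_inj _ s)).
by case=> _; rewrite eqxx => /esym/forallP /= H j; apply/eqP/H.
Qed.

Section SortPerm.
Variables (n : nat) (g : 'I_n -> nat).
Hypothesis g_inj : injective g.

Lemma rank_proof j : #|[set i | g i < g j]| < n.
Proof.
rewrite -[X in _ < X]card_ord; apply: proper_card.
by apply/properP; split; [exact/subsetP | exists j; rewrite ?inE ?ltnn].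
Qed.

Definition rank_fun j : 'I_n := Ordinal (rank_proof j).

Lemma rank_fun_lt i j : g i < g j -> rank_fun i < rank_fun j.
Proof.
move=> gij; apply: proper_card; apply/properP; split.
  by apply/subsetP => x; rewrite !inE => /ltn_trans->.
by exists i; rewrite !inE ?ltnn.
Qed.

Lemma rank_fun_inj : injective rank_fun.
Proof.
move=> i j eqr; apply: g_inj; case: (ltngtP (g i) (g j)) => // /rank_fun_lt;
by rewrite eqr ltnn.
Qed.

(** It sends an index to its place in the order given by [g], not a place to the index found
    there. *)
Definition sort_perm : {perm 'I_n} := perm rank_fun_inj.

Lemma sort_perm_lt i j : (sort_perm i < sort_perm j) = (g i < g j).
Proof.
rewrite !permE; apply/idP/idP; last exact: rank_fun_lt.
case: (ltngtP (g i) (g j)) => //; last by move=> /g_inj->; rewrite ltnn.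
by move=> /rank_fun_lt /ltnW; rewrite leqNgt => /negPf->.
Qed.

End SortPerm.

(** * Positive reduction and descent sets *)

Definition rank_pos (w : seq int) (x : int) : int :=
  if (0 < x)%R then Posz (size (undup [seq y <- w | (0 < y)%R && (y <= x)%R]))
  else x.

Lemma red_posE w : red_pos w = map (rank_pos w) w.
Proof. by []. Qed.

Lemma rank_pos_gt0 w x : x \in w -> (0 < rank_pos w x)%R = (0 < x)%R.
Proof.
move=> xw; rewrite /rank_pos; case: ifP => // x0.
rewrite ltz_nat; have : x \in undup [seq y <- w | (0 < y)%R && (y <= x)%R].
  by rewrite mem_undup mem_filter x0 lexx.
by case: undup.
Qed.

Lemma rank_pos_lt w x y :
  x \in w -> y \in w -> (rank_pos w x < rank_pos w y)%R = (x < y)%R.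
Proof.
move=> xw yw; have := rank_pos_gt0 xw; have := rank_pos_gt0 yw.
rewrite /rank_pos; case: (ltP 0%R x) => x0; case: (ltP 0%R y) => y0 //; try lia.
move=> _ _; rewrite ltz_nat; case: (ltP x y) => [xy|yx].
  apply: (@leq_trans (size (y :: undup [seq z <- w | (0 < z)%R && (z <= x)%R]))) => //.
  apply: uniq_leq_size => [|z].
    by rewrite cons_uniq undup_uniq andbT mem_undup mem_filter (leNgt y x) xy andbF.
  rewrite inE => /predU1P[->|]; first by rewrite mem_undup mem_filter y0 lexx.
  by rewrite !mem_undup !mem_filter => /andP[/andP[-> zx] ->]; rewrite (le_trans zx) ?ltW.
apply/negbTE; rewrite -leqNgt; apply: uniq_leq_size; rewrite ?undup_uniq // => z.
by rewrite !mem_undup !mem_filter => /andP[/andP[-> zx] ->]; rewrite (le_trans zx).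
Qed.

(** The rank of a positive letter counts positive letters only, so the others may be deleted
    first. *)
Lemma Posw_red_pos w : Posw (red_pos w) = red_pos (Posw w).
Proof.
rewrite /Posw !red_posE filter_map.
rewrite (eq_in_filter (a2 := fun x => (0 < x)%R)); last first.
  by move=> x xw /=; rewrite rank_pos_gt0.
apply/eq_in_map => x _; rewrite /rank_pos; case: ifP => // _; congr (Posz (size _)).
rewrite -filter_predI; congr undup; apply: eq_filter => y /=.
by case: (0 < y)%R; rewrite ?andbF ?andbT.
Qed.

Lemma eq_red_pos (T : eqType) (f g : T -> int) (s : seq T) :
    uniq s -> injective f -> injective g ->
    (forall x, 0 < f x)%R -> (forall x, 0 < g x)%R ->
    {in s &, forall x y, (f x <= f y)%R = (g x <= g y)%R} ->
  red_pos (map f s) = red_pos (map g s).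
Proof.
move=> Us fI gI f0 g0 fg; rewrite !red_posE -!map_comp; apply/eq_in_map => x xs /=.
rewrite /rank_pos f0 g0 !filter_map !undup_id ?map_inj_uniq ?filter_uniq //.
rewrite !size_map; congr (Posz (size _)); apply: eq_in_filter => y ys /=.
by rewrite f0 g0 fg.
Qed.

(** A descent is recorded by the 0-based index of its smaller letter, which is its 1-based position
    in [DESw]. A finite set makes counting by inclusion possible. *)
Definition DESset n (w : seq int) : {set 'I_n} :=
  [set i : 'I_n | (0 < i) && (nth (Posz 0) w i < nth (Posz 0) w i.-1)%R].

Lemma DESw_inj n w w' :
  size w = n -> size w' = n -> DESset n w = DESset n w' -> DESw w = DESw w'.
Proof.
move=> sw sw' /setP H; rewrite /DESw sw sw'; apply: eq_in_filter => i.
rewrite mem_iota => /andP[i0 ltin]; have lt : i < n by lia.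
by have := H (Ordinal lt); rewrite !inE /= i0.
Qed.

Lemma DESset_red_pos n w : size w = n -> DESset n (red_pos w) = DESset n w.
Proof.
move=> sw; apply/setP => i; rewrite !inE; case: (posnP i) => //= i0.
have ltn := ltn_ord i.
by rewrite red_posE !(nth_map (Posz 0)) ?rank_pos_lt ?mem_nth ?sw //; lia.
Qed.

(** * Letters and keys *)

Section Words.
Variables (n k : nat).
Implicit Types (a : karr n k) (p : pred 'I_k).

(* [p] tells which colours are written as negative letters: all of them gives the
   word of [df], all but the last one gives the word of [pf]. *)
Definition letter p a (i : 'I_n) : int :=
  match kcol a i with
  | Some c => if p c then (- Posz c.+1)%R else Posz (kperm a i).+1
  | None => Posz (kperm a i).+1
  end.

Definition word p a := [seq letter p a i | i <- enum 'I_n].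

Lemma size_word p a : size (word p a) = n.
Proof. by rewrite size_map size_enum_ord. Qed.

Lemma nth_word p a (i : 'I_n) : nth (Posz 0) (word p a) i = letter p a i.
Proof. by rewrite (nth_map i) ?nth_ord_enum // size_enum_ord. Qed.

Lemma kfix a i : (kperm a i == i) = (kcol a i != None).
Proof. by have /forallP/(_ i)/eqP := valP a. Qed.

Lemma kfixP a i : kcol a i != None -> kperm a i = i.
Proof. by rewrite -kfix => /eqP. Qed.

Lemma kcol_perm a i : kcol a i = None -> kcol a (kperm a i) = None.
Proof.
move=> ci; apply/eqP/negPn; rewrite -kfix (inj_eq perm_inj) kfix.
by rewrite ci.
Qed.

Lemma karr_inj a b : kperm a =1 kperm b -> kcol a =1 kcol b -> a = b.
Proof.
move=> eqp eqc; apply: val_inj; move: eqp eqc; rewrite /kperm /kcol.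
by case: (val a) (val b) => [? ?] [? ?] /= /permP-> /ffunP->.
Qed.

Definition exc a (i : 'I_n) : bool := i < kperm a i.

Lemma exc_col a i : kcol a i != None -> exc a i = false.
Proof. by move=> /kfixP; rewrite /exc => ->; rewrite ltnn. Qed.

(* The order in which letters occur in a descent-free block; [e] marks the
   excedances among the uncoloured positions. *)
Definition key p (x : option 'I_k) (e : bool) : nat :=
  match x with
  | Some c => if p c then k.-1 - c else k.+1
  | None => k + e.*2
  end.

Lemma key_lt p x e : key p x e < k.+3.
Proof. by case: x => [c|] /=; [case: ifP; lia | case: e => /=; lia]. Qed.

Definition akey p a i := key p (kcol a i) (exc a i).

(** Adjacency matters: next to a fixed point written as a positive letter, an uncoloured letter is
    larger exactly when it is an excedance, since no value lies strictly between [i] and [j]. Such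
    fixed points get key [k.+1], between the keys [k] and [k.+2] of uncoloured positions. *)
Lemma letter_le p a (i j : 'I_n) : j = i.+1 :> nat ->
  (letter p a i <= letter p a j)%R =
  (akey p a i <= akey p a j) &&
  ((kcol a i == None) && (kcol a j == None) ==> (kperm a i < kperm a j)).
Proof.
move=> ji; have Dij : i != j by apply/eqP => ij; move: ji; rewrite ij; lia.
have : kperm a i != kperm a j by rewrite (inj_eq perm_inj).
have := kfix a i; have := kfix a j.
rewrite /letter /akey /exc -!val_eqE /=.
move: (ltn_ord (kperm a i)) (ltn_ord (kperm a j)).
case: (kcol a i) => [c|]; case: (kcol a j) => [d|] //=;
  try have := ltn_ord c; try have := ltn_ord d.
all: try case: (p c); try case: (p d).
all: rewrite ?implybT ?andbT ?implyTb ?implyFb.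
all: try (case: ltnP); try (case: ltnP); try lia.
Qed.

End Words.

(** * Words without descents inside blocks *)

Section Blocks.
Variables (n : nat) (S : {set 'I_n}).

(** The index of the block containing [i]; each element of [S] starts a new block. *)
Definition block (i : 'I_n) : nat := #|[set s in S | s <= i]|.

Lemma block_mono (i j : 'I_n) : i <= j -> block i <= block j.
Proof.
move=> ij; apply/subset_leq_card/subsetP => s; rewrite !inE => /andP[-> si].
exact: leq_trans si ij.
Qed.

Lemma block_succ (i j : 'I_n) :
  j = i.+1 :> nat -> (block i == block j) = (j \notin S).
Proof.
move=> ji; apply/eqP/idP => [eqb|jS].
  apply/negP => jS; suff : block i < block j by rewrite eqb ltnn.
  apply: proper_card; apply/properP; split.
    by apply/subsetP => s; rewrite !inE => /andP[->]; lia.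
  by exists j; rewrite !inE jS ?leqnn //=; lia.
apply: eq_card => s; rewrite !inE; case sS: (s \in S) => //=.
have : s != j by apply: contraNneq jS => <-.
by rewrite -val_eqE /=; lia.
Qed.

Lemma block_trans_rel (R : 'I_n -> 'I_n -> Prop) :
    (forall y x z, R x y -> R y z -> R x z) ->
    (forall i j : 'I_n, j = i.+1 :> nat -> block i = block j -> R i j) ->
  forall i j : 'I_n, i < j -> block i = block j -> R i j.
Proof.
move=> Rtr Rsucc i [m]; elim: m => // m IH lt_m /= ltim eqb.
have lt_m' : m < n by exact: ltnW.
have [eqim|neim] := eqVneq (i : nat) m; first by apply: Rsucc => //=; rewrite eqim.
have ltim' : i < m by lia.
have b1 : block i <= block (Ordinal lt_m') by apply: block_mono; rewrite /= ltnW.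
have b2 : block (Ordinal lt_m') <= block (Ordinal lt_m) by apply: block_mono => /=.
apply: (Rtr (Ordinal lt_m')); first by apply: IH => //; lia.
by apply: Rsucc => //; lia.
Qed.

Definition block_sorted k (p : pred 'I_k) (a : karr n k) := forall i j : 'I_n,
  i < j -> block i = block j ->
  akey p a i <= akey p a j /\
  (kcol a i = None -> kcol a j = None -> kperm a i < kperm a j).

Lemma DESset_subP k (p : pred 'I_k) (a : karr n k) :
  reflect (block_sorted p a) (DESset n (word p a) \subset S).
Proof.
apply: (iffP subsetP) => [sub|sorted j].
  have letter_succ (i j : 'I_n) : j = i.+1 :> nat -> block i = block j ->
      (letter p a i <= letter p a j)%R.
    move=> ji /eqP; rewrite (block_succ ji) => jS.
    have := contra (sub j) jS; rewrite inE ji /= -ji !nth_word.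
    by rewrite -leNgt.
  move=> i j ltij eqb; split.
    move: i j ltij eqb; apply: (block_trans_rel (R := fun i j => akey p a i <= akey p a j)).
      by move=> y x z; apply: leq_trans.
    by move=> i j ji eqb; have := letter_succ _ _ ji eqb; rewrite letter_le // => /andP[].
  move=> ci cj.
  (* The comparison of [kperm] values does not chain through coloured positions in between; that of
     letters is transitive. *)
  have : (letter p a i <= letter p a j)%R.
    move: i j ltij eqb {ci cj}; apply: block_trans_rel => // y x z; exact: le_trans.
  rewrite /letter ci cj; have : kperm a i != kperm a j.
    by rewrite (inj_eq perm_inj) -val_eqE /=; lia.
  by rewrite -val_eqE /=; lia.
rewrite inE => /andP[j0]; have lti : j.-1 < n by have := ltn_ord j; lia.
have ji : j = (Ordinal lti).+1 :> nat by rewrite /= prednK.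
rewrite -[j.-1]/(nat_of_ord (Ordinal lti)) !nth_word => lt.
apply: contraLR lt; rewrite -(block_succ ji) -leNgt letter_le // => /eqP eqb.
have ltij : Ordinal lti < j by rewrite /=; lia.
have [-> H] := sorted _ _ ltij eqb.
by apply/implyP => /andP[/eqP ci /eqP cj]; apply: H.
Qed.

End Blocks.

(** * Relabelling positions and colours *)

Section Relabel.
Variables (n k : nat).
Implicit Types (a : karr n k) (s : {perm 'I_n}) (r : {perm 'I_k}).

(* Conjugating by [s] moves fixed points together with their colours, and keeps
   [Der] as soon as [s] is increasing on the uncoloured positions. *)
Definition relabel_pair s r a : {perm 'I_n} * {ffun 'I_n -> option 'I_k} :=
  ((kperm a ^ s)%g, [ffun j => omap r (kcol a ((s^-1)%g j))]).

Lemma relabel_ok s r a : arr_ok (relabel_pair s r a).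
Proof.
apply/forallP => j /=; rewrite ffunE -{1 2}(permKV s j) permJ (inj_eq perm_inj).
by rewrite kfix; case: (kcol a _).
Qed.

Definition relabel s r a : karr n k :=
  exist (fun x => arr_ok x) _ (relabel_ok s r a).

Lemma kperm_relabel s r a i : kperm (relabel s r a) (s i) = s (kperm a i).
Proof. by rewrite /kperm /= permJ. Qed.

Lemma kcol_relabel s r a i : kcol (relabel s r a) (s i) = omap r (kcol a i).
Proof. by rewrite /kcol /= ffunE permK. Qed.

Lemma fixc_relabel s r a c : fixc (relabel s r a) (r c) = fixc a c.
Proof.
rewrite /fixc -[RHS](card_imset _ (@perm_inj _ s)); apply: eq_card => j.
rewrite -(permKV s j) (mem_imset _ _ (@perm_inj _ s)) !inE kcol_relabel.
by case: (kcol a _) => //= d; rewrite !(inj_eq Some_inj) (inj_eq perm_inj).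
Qed.

Section Monotone.
Variables (s : {perm 'I_n}) (r : {perm 'I_k}) (a : karr n k).
Hypothesis s_mono : forall i j : 'I_n, kcol a i = kcol a j -> i < j -> s i < s j.

Lemma relabel_lt (i j : 'I_n) : kcol a i = kcol a j -> (s i < s j) = (i < j).
Proof.
move=> eqc; apply/idP/idP; last exact: s_mono.
by case: (ltngtP i j) => // [/(s_mono (esym eqc))|/val_inj->]; lia.
Qed.

(** If [i] is uncoloured so is its image under [kperm a], hence [s] preserves their order. *)
Lemma exc_relabel i : exc (relabel s r a) (s i) = exc a i.
Proof.
rewrite /exc kperm_relabel; case ci: (kcol a i) => [c|].
  by rewrite kfixP ?ci // !ltnn.
by rewrite relabel_lt // ci kcol_perm.
Qed.

Definition uncol a : seq 'I_n := [seq i <- enum 'I_n | kcol a i == None].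

Lemma sorted_uncol b : sorted ltn (map val (uncol b)).
Proof.
rewrite sorted_map; apply: sorted_filter; first by move=> ? ? ?; apply: ltn_trans.
by have := iota_ltn_sorted 0 n; rewrite -val_enum_ord sorted_map.
Qed.

(** Both lists are strictly increasing and have the same elements. *)
Lemma uncol_relabel : uncol (relabel s r a) = map s (uncol a).
Proof.
apply: (inj_map val_inj); apply: (irr_sorted_eq ltn_trans ltnn).
- exact: sorted_uncol.
- rewrite -map_comp sorted_map.
  apply: (sub_in_sorted (P := fun i => kcol a i == None) (e := relpre val ltn)).
  + by move=> i j /eqP ci /eqP cj /=; apply: s_mono; rewrite ci.
  + by apply/allP => i; rewrite mem_filter => /andP[].
  + by have := sorted_uncol a; rewrite sorted_map.
- move=> x; apply/mapP/mapP => -[y + ->].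
    rewrite mem_filter -(permKV s y) kcol_relabel => /andP[cy _].
    exists (s ((s^-1)%g y)) => //; apply: map_f.
    by rewrite mem_filter mem_enum andbT; case: (kcol a _) cy.
  case/mapP => z; rewrite mem_filter => /andP[/eqP cz _] ->.
  by exists (s z); rewrite // mem_filter kcol_relabel cz mem_enum.
Qed.

End Monotone.

Lemma DerE a : Der a = red_pos [seq Posz (kperm a i).+1 | i <- uncol a].
Proof.
rewrite /Der /df Posw_red_pos; congr red_pos.
rewrite /Posw filter_map (eq_filter (a2 := fun i => kcol a i == None)).
  by apply/eq_in_map => i; rewrite mem_filter => /andP[/eqP->].
by move=> i /=; case: (kcol a i).
Qed.

Lemma Der_relabel s r a :
  (forall i j : 'I_n, kcol a i = kcol a j -> i < j -> s i < s j) ->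
  Der (relabel s r a) = Der a.
Proof.
move=> s_mono; rewrite !DerE uncol_relabel // -map_comp.
rewrite (eq_map (g := fun i => Posz (s (kperm a i)).+1)); last first.
  by move=> i /=; rewrite kperm_relabel.
apply: eq_red_pos => //.
- by rewrite filter_uniq ?enum_uniq.
- by move=> i j [] /val_inj/perm_inj/perm_inj.
- by move=> i j [] /val_inj/perm_inj.
move=> i j; rewrite !mem_filter => /andP[/eqP ci _] /andP[/eqP cj _].
by rewrite !lez_nat !ltnS leqNgt (relabel_lt s_mono) -?leqNgt // !kcol_perm.
Qed.

End Relabel.

(** * Resorting the blocks *)

Lemma lex_encode_lt B x y u v : u < B -> v < B ->
  (x * B + u < y * B + v) = (x < y) || (x == y) && (u < v).
Proof. by move=> uB vB; case: (ltngtP x y) => H /=; nia. Qed.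

Section Resort.
Variables (n k : nat) (S : {set 'I_n}) (p p' : pred 'I_k) (r : {perm 'I_k}).
Implicit Types (a b : karr n k).

Definition new_key a i := key p' (omap r (kcol a i)) (exc a i).

(** The triple of block, future key and old position, in lexicographic order, packed into one
    number: keys are below [k.+3] and positions below [n]. The last entry makes the sort stable. *)
Definition sort_code a (i : 'I_n) : nat :=
  (block S i * k.+3 + new_key a i) * n + i.

Lemma sort_code_lt a (i j : 'I_n) : (sort_code a i < sort_code a j) =
  (block S i < block S j) || (block S i == block S j) &&
    ((new_key a i < new_key a j) || (new_key a i == new_key a j) && (i < j)).
Proof.
rewrite lex_encode_lt // lex_encode_lt ?key_lt //.
have := key_lt p' (omap r (kcol a i)) (exc a i).
have := key_lt p' (omap r (kcol a j)) (exc a j).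
rewrite -!/(new_key _ _) => ki kj.
by case: (ltngtP (block S i) (block S j)) => H //=; case: (ltngtP (new_key a i) (new_key a j)) => //=; nia.
Qed.

Lemma sort_code_inj a : injective (sort_code a).
Proof.
move=> i j eqc; apply: val_inj; have := sort_code_lt a i j.
have := sort_code_lt a j i; rewrite eqc ltnn /= => H1 H2; lia.
Qed.

Definition sorter a := sort_perm (@sort_code_inj a).

Lemma block_sorter a i : block S (sorter a i) = block S i.
Proof.
apply: perm_block; first exact: block_mono.
by move=> x y lt; rewrite sort_perm_lt sort_code_lt lt.
Qed.

Lemma sorter_lt a (i j : 'I_n) : block S i = block S j ->
  (sorter a i < sorter a j) =
  (new_key a i < new_key a j) || (new_key a i == new_key a j) && (i < j).
Proof. by move=> eqb; rewrite sort_perm_lt sort_code_lt eqb ltnn eqxx. Qed.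

Definition resort a := relabel (sorter a) r a.

Section Sorted.
Variable a : karr n k.
Hypothesis sorted_a : block_sorted S p a.

(** Positions of one colour have equal new keys, so stability applies. Uncoloured ones in a block
    already have non-excedances before excedances. *)
Lemma sorter_mono (i j : 'I_n) :
  kcol a i = kcol a j -> i < j -> sorter a i < sorter a j.
Proof.
move=> eqc lt_ij; have := block_mono S (ltnW lt_ij); rewrite leq_eqVlt.
case/predU1P => [eqb|ltb]; last first.
  by rewrite sort_perm_lt sort_code_lt ltb.
rewrite sorter_lt //; suff : new_key a i <= new_key a j.
  by rewrite leq_eqVlt lt_ij andbT orbC.
have [le_key _] := sorted_a lt_ij eqb.
case cj: (kcol a j) => [c|]; rewrite /new_key eqc ?cj.
  by rewrite !exc_col ?eqc ?cj.
move: le_key; rewrite /akey eqc cj /=.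
by case: (exc a i); case: (exc a j); lia.
Qed.

Lemma akey_resort i : akey p' (resort a) (sorter a i) = new_key a i.
Proof.
by rewrite /akey kcol_relabel exc_relabel //; apply: sorter_mono.
Qed.

Lemma resort_sorted : block_sorted S p' (resort a).
Proof.
move=> u v; rewrite -(permKV (sorter a) u) -(permKV (sorter a) v).
move: (_ u) (_ v) => i j; rewrite !block_sorter => lt_uv eqb; split.
  by move: lt_uv; rewrite !akey_resort sorter_lt //; lia.
rewrite !kcol_relabel !kperm_relabel.
case ci: (kcol a i) => //; case cj: (kcol a j) => // _ _.
have eqc : kcol a i = kcol a j by rewrite ci.
have lt_ij : i < j by rewrite -(relabel_lt sorter_mono).
have [_ H] := sorted_a lt_ij eqb.
by rewrite (relabel_lt sorter_mono) ?H ?kcol_perm.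
Qed.

Lemma Der_resort : Der (resort a) = Der a.
Proof. by apply: Der_relabel; apply: sorter_mono. Qed.

End Sorted.

Lemma fixc_resort a c : fixc (resort a) (r c) = fixc a c.
Proof. exact: fixc_relabel. Qed.

Hypothesis p_inj : forall c d, ~~ p c -> ~~ p d -> c = d.

(** Colours in [p] have distinct keys below [k], uncoloured positions have [k] or [k.+2], and [k.+1]
    belongs to the only colour that [p] may omit. *)
Lemma key_inj (x y : option 'I_k) e f :
  (x != None -> e = false) -> (y != None -> f = false) ->
  key p x e = key p y f -> x = y.
Proof.
case: x y => [c|] [d|] //= ex fy.
- move: (p_inj (c := c) (d := d)) (ltn_ord c) (ltn_ord d).
  case: (p c); case: (p d) => //= H ltc ltd; try lia.
    by move=> eqcd; congr Some; apply: val_inj => /=; lia.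
  by rewrite H.
- by case: ifP => _; case: f {fy}; have := ltn_ord c; lia.
- by case: ifP => _; case: e {ex}; have := ltn_ord d; lia.
Qed.

Lemma akey_inj a i j : akey p a i = akey p a j -> kcol a i = kcol a j.
Proof. by apply: key_inj; apply: exc_col. Qed.

(** The permutation [t] carries [a] to [b], preserving colours, blocks and keys. As both are sorted,
    [t] is increasing, hence the identity. *)
Lemma resort_inj a b :
  block_sorted S p a -> block_sorted S p b -> resort a = resort b -> a = b.
Proof.
move=> sa sb eqr; pose t := (sorter a * (sorter b)^-1)%g.
have tE i : sorter b (t i) = sorter a i by rewrite permM permKV.
have colt i : kcol b (t i) = kcol a i.
  apply: (inj_omap (@perm_inj _ r)).
  by rewrite -(kcol_relabel (sorter b)) tE -/(resort b) -eqr kcol_relabel.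
have permt i : kperm b (t i) = t (kperm a i).
  apply: (@perm_inj _ (sorter b)).
  by rewrite -(kperm_relabel _ r) !tE -/(resort b) -eqr kperm_relabel.
have blkt i : block S (t i) = block S i by rewrite -(block_sorter b) tE block_sorter.
have t_mono (i j : 'I_n) : kcol a i = kcol a j -> i < j -> t i < t j.
  move=> eqc lt_ij; rewrite -(relabel_lt (sorter_mono sb)) ?colt // !tE.
  exact: sorter_mono.
have keyt i : akey p b (t i) = akey p a i.
  rewrite /akey colt; congr key; rewrite /exc permt.
  case ci: (kcol a i) => [c|]; first by rewrite kfixP ?ci // !ltnn.
  by rewrite (relabel_lt t_mono) // ci kcol_perm.
(* [t] is increasing: source and target are both sorted by the same key. *)
have t_lt (i j : 'I_n) : i < j -> t i < t j.
  move=> lt_ij; have := block_mono S (ltnW lt_ij); rewrite leq_eqVlt.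
  case/predU1P => [eqb|ltb]; last first.
    by rewrite ltnNge; apply/negP => /(block_mono S); rewrite !blkt; lia.
  have [le_key _] := sa _ _ lt_ij eqb.
  have [/akey_inj eqc|ne_key] := eqVneq (akey p a i) (akey p a j).
    exact: t_mono.
  rewrite ltnNge leq_eqVlt; apply/negP => /predU1P[/val_inj/perm_inj eqij|lt_ji].
    by move: lt_ij; rewrite eqij ltnn.
  have [] := sb _ _ lt_ji; first by rewrite !blkt.
  by rewrite !keyt => le_key'; case/eqP: ne_key; lia.
have t1 i : t i = i.
  (* With [val] as block function every block is a single position. *)
  by apply: val_inj; apply: (@perm_block _ t val).
apply: karr_inj => i; last by rewrite -colt t1.
by rewrite -{1}(t1 (kperm a i)) -permt t1.
Qed.

End Resort.

(** * Comparison of cardinalities and conclusion *)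

(** [resort] injects the first set into the second. With [p] and [p'] exchanged and [r] inverted,
    this also gives the reverse inequality. *)
Lemma leq_card_sorted n k (S : {set 'I_n}) (p p' : pred 'I_k) (r : {perm 'I_k})
    (m m' : 'I_k -> nat) (d : seq int) :
    (forall c d, ~~ p c -> ~~ p d -> c = d) -> (forall c, m' (r c) = m c) ->
  #|[set a : karr n k | [&& [forall c, fixc a c == m c], Der a == d &
       DESset n (word p a) \subset S]]| <=
  #|[set a : karr n k | [&& [forall c, fixc a c == m' c], Der a == d &
       DESset n (word p' a) \subset S]]|.
Proof.
move=> p_inj m_r.
rewrite -(card_in_imset (f := resort S p' r)); last first.
  move=> a b; rewrite !inE => /and3P[_ _ /DESset_subP sa] /and3P[_ _ /DESset_subP sb].
  exact: (resort_inj p_inj).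
apply/subset_leq_card/subsetP => _ /imsetP[a + ->]; rewrite !inE.
case/and3P => /forallP ma /eqP <- /DESset_subP sa.
rewrite (Der_resort _ _ sa) eqxx; apply/andP; split=> /=.
  by apply/forallP => c; rewrite -(permKV r c) fixc_resort m_r.
by apply/DESset_subP; apply: resort_sorted sa.
Qed.

Theorem theorem1p1 (n k : nat) (m : 'I_k -> nat) (tau : {perm 'I_k}) :
  0 < n -> 0 < k ->
  exists Phi : karr_m n m -> karr_m n (fun i => m (tau i)),
    bijective Phi /\
    forall a : karr_m n m,
      DEZ (val a) = DES (val (Phi a)) /\ Der (val a) = Der (val (Phi a)).
Proof.
move=> _ _; pose z : pred 'I_k := xpredT; pose s : pred 'I_k := fun c => c.+1 != k.
have z_inj c d : ~~ z c -> ~~ z d -> c = d by [].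
have s_inj c d : ~~ s c -> ~~ s d -> c = d.
  by rewrite !negbK => /eqP eqc /eqP eqd; apply: val_inj => /=; lia.
have dfE a : df a = red_pos (word z a) by [].
have pfE a : pf a = red_pos (word s a) by [].
pose f (a : karr_m n m) := (DESset n (word z (val a)), Der (val a)).
pose g (a : karr_m n (fun i => m (tau i))) := (DESset n (word s (val a)), Der (val a)).
have [|Phi [bijPhi fg]] := @bij_of_fibres _ _ _ f g; last first.
  exists Phi; split=> // a; have [eqS eqD] := fg a; split=> //.
  rewrite /DEZ /DES dfE pfE; apply: (DESw_inj (n := n)).
  - by rewrite size_map size_word.
  - by rewrite size_map size_word.
  - by rewrite !DESset_red_pos ?size_word.
move=> [T d].
have card_sub (mm : 'I_k -> nat) (P : pred (karr n k)) :
    #|[set a : karr_m n mm | P (val a)]| =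
    #|[set a : karr n k | [forall c, fixc a c == mm c] && P a]|.
  rewrite -(card_imset _ val_inj); apply: eq_card => a; rewrite inE.
  apply/imsetP/andP => [[b]|[ma Pa]].
    by rewrite inE => Pb ->; split=> //; apply: valP b.
  by exists (Sub a ma); rewrite ?inE.
have fibreE (p : pred 'I_k) (mm : 'I_k -> nat) :
    #|[set a : karr_m n mm | (DESset n (word p (val a)), Der (val a)) == (T, d)]| =
    #|[set a : karr n k | [forall c, fixc a c == mm c] && (Der a == d)
        & DESset n (word p a) == T]|.
  rewrite (card_sub mm (fun a => (DESset n (word p a), Der a) == (T, d))).
  by apply: eq_card => a; rewrite !inE xpair_eqE -andbA (andbC (Der a == d)).
rewrite /f /g !fibreE; apply: card_fibre_of_subset => S.
have assoc (p : pred 'I_k) (mm : 'I_k -> nat) :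
    #|[set a : karr n k | [forall c, fixc a c == mm c] && (Der a == d)
        & DESset n (word p a) \subset S]| =
    #|[set a : karr n k | [&& [forall c, fixc a c == mm c], Der a == d
        & DESset n (word p a) \subset S]]|.
  by apply: eq_card => a; rewrite !inE andbA.
rewrite !assoc; apply/eqP; rewrite eqn_leq; apply/andP; split.
  (* From [df] to [pf] the colours move by the inverse of [tau], because the target has [m (tau c)]
     letters of colour [c]; the way back uses [tau]. *)
  by apply: (@leq_card_sorted n k S _ _ (tau^-1)%g) => // c; rewrite permKV.
exact: (@leq_card_sorted n k S _ _ tau).
Qed.
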